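(* Let $k$ be a field and let $\Delta$ be a pure simplicial complex on the vertex set $[n]=\{1,\ldots,n\}$. The following statements are equivalent: (a) $\Delta$ is constructible. (b) $I_{\Delta^\vee}$ is a square-free constructible ideal of $k[x_1,\ldots,x_n]$.
   Context: A simplicial complex on $[n]$ is a collection of subsets (faces) of $[n]$ closed under taking subsets and containing all singletons $\{i\}$, $i\in[n]$ (for auxiliary subcomplexes and Alexander duals on $[n]$ the last condition is not required). Facets are the maximal faces, $\dim F=|F|-1$, $\dim\Delta$ is the maximal dimension of a face, and $\Delta$ is pure if all its facets have the same dimension. A simplex is a simplicial complex with exactly one facet (including $\{\emptyset\}$, of dimension $-1$). Constructible simplicial complexes are the pure simplicial complexes obtained recursively: (i) any simplex is constructible; (ii) if $\Delta_1,\Delta_2$ are $d$-dimensional constructible simplicial complexes and $\Delta_1\cap\Delta_2$ is a constructible simplicial complex of dimension $d-1$, then $\Delta_1\cup\Delta_2$ is a $d$-dimensional constructible simplicial complex. The Alexander dual is $\Delta^\vee=\{[n]\setminus F: F\subseteq[n],\ F\notin\Delta\}$. The Stanley--Reisner ideal of a complex $\Gamma$ on $[n]$ is $I_\Gamma=(x_F: F\subseteq[n],\ F\notin\Gamma)$ with $x_F=\prod_{i\in F}x_i$; thus $I_{\Delta^\vee}$ is generated by the monomials $x_{[n]\setminus F}$, $F$ a facet of $\Delta$. A monomial ideal of $S=k[x_1,\ldots,x_n]$ generated in a single degree $q$ is a constructible ideal if it can be obtained by the following recursive procedure: (i) if $u$ is a monomial of $S$ and $I=(u)$, then $I$ is constructible;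 (ii) if $I_1,I_2$ are constructible ideals generated in degree $q$ and $I_1\cap I_2$ is a constructible ideal generated in degree $q+1$, then $I_1+I_2$ is constructible. A square-free constructible ideal is a constructible ideal which is a square-free monomial ideal. *)

(* Defs.v *)
From HB Require Import structures.
From mathcomp Require Import all_boot all_order all_algebra.
From mathcomp Require Import mpoly.
From mathcomp Require Import boolp classical_sets.

Set Implicit Arguments.
Unset Strict Implicit.
Unset Printing Implicit Defensive.

Import GRing.Theory.

Local Open Scope ring_scope.

(** * Simplicial complexes

    The vertex set [{1, ..., n}] is represented by ['I_n] and a family of faces
    by [D : {set {set 'I_n}}]. *)

(** Vertices need not be faces here: this is the notion used for auxiliary
    subcomplexes and Alexander duals. *)
Definition simplicial_complex (n : nat) (D : {set {set 'I_n}}) : Prop :=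
  forall F G : {set 'I_n}, F \in D -> G \subset F -> G \in D.

Definition simplicial_complex_on (n : nat) (D : {set {set 'I_n}}) : Prop :=
  simplicial_complex D /\ forall i : 'I_n, [set i]%SET \in D.

Definition face_dim (n : nat) (F : {set 'I_n}) : int := #|F|%:Z - 1.

(** The dimension of [{set0}] is [-1].  The family without any face also gets the
    junk value [-1], but it has no facet, so it is never constructible below. *)
Definition complex_dim (n : nat) (D : {set {set 'I_n}}) : int :=
  (\max_(F in D) #|F|)%N%:Z - 1.

Definition facets (n : nat) (D : {set {set 'I_n}}) : {set {set 'I_n}} :=
  [set F | maxset (fun G : {set 'I_n} => G \in D) F]%SET.

Definition pure_complex (n : nat) (D : {set {set 'I_n}}) : Prop :=
  {in facets D &, forall F G : {set 'I_n}, face_dim F = face_dim G}.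

Definition is_simplex (n : nat) (D : {set {set 'I_n}}) : Prop :=
  simplicial_complex D /\ #|facets D| = 1%N.

(** Purity is not a premise: the two rules produce only pure complexes, see
    [constructible_complex_pure]. *)
Inductive constructible_complex (n : nat) : {set {set 'I_n}} -> Prop :=
| ConstructibleSimplex (D : {set {set 'I_n}}) :
    is_simplex D -> constructible_complex D
| ConstructibleUnion (d : int) (D1 D2 : {set {set 'I_n}}) :
    constructible_complex D1 -> complex_dim D1 = d ->
    constructible_complex D2 -> complex_dim D2 = d ->
    constructible_complex (D1 :&: D2) -> complex_dim (D1 :&: D2) = d - 1 ->
    constructible_complex (D1 :|: D2).

Definition alexander_dual (n : nat) (D : {set {set 'I_n}}) : {set {set 'I_n}} :=
  [set ~: F | F : {set 'I_n} & F \notin D]%SET.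

(** * Ideals of [k[x_1, ..., x_n]] *)

Local Open Scope classical_set_scope.

(** The unit ideal is allowed, unlike in [idealr_closed]: the ideal attached to
    the full simplex is [(1)]. *)
Definition is_ideal (R : comNzRingType) (I : set R) : Prop :=
  [/\ I 0,
      forall p q : R, I p -> I q -> I (p + q)
    & forall a p : R, I p -> I (a * p)].

Definition ideal_gen (R : comNzRingType) (G : set R) : set R :=
  smallest (@is_ideal R) G.

Definition ideal_add (R : comNzRingType) (I J : set R) : set R :=
  [set p + q | p in I & q in J].

Definition monomial_ideal_gen (k : fieldType) (n : nat) (M : set 'X_{1..n}) :
    set {mpoly k[n]} :=
  ideal_gen [set 'X_[m] | m in M].
Arguments monomial_ideal_gen k {n} M.

Definition generated_in_degree (k : fieldType) (n q : nat)
    (I : set {mpoly k[n]}) : Prop :=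
  exists M : set 'X_{1..n},
    (forall m, M m -> mdeg m = q) /\ I = monomial_ideal_gen k M.

Definition squarefree_monomial_ideal (k : fieldType) (n : nat)
    (I : set {mpoly k[n]}) : Prop :=
  exists M : set 'X_{1..n},
    (forall m, M m -> forall i : 'I_n, (m i <= 1)%N)
    /\ I = monomial_ideal_gen k M.

(** That the ideal is monomial and generated in a single degree is not a premise
    of the rules but a consequence, see [constructible_ideal_generated]. *)
Inductive constructible_ideal (k : fieldType) (n : nat) :
    set {mpoly k[n]} -> Prop :=
| ConstructiblePrincipal (u : 'X_{1..n}) :
    constructible_ideal (ideal_gen [set 'X_[u]])
| ConstructibleSum (q : nat) (I1 I2 : set {mpoly k[n]}) :
    constructible_ideal I1 -> generated_in_degree q I1 ->
    constructible_ideal I2 -> generated_in_degree q I2 ->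
    constructible_ideal (I1 `&` I2) -> generated_in_degree q.+1 (I1 `&` I2) ->
    constructible_ideal (ideal_add I1 I2).

Definition squarefree_constructible_ideal (k : fieldType) (n : nat)
    (I : set {mpoly k[n]}) : Prop :=
  constructible_ideal I /\ squarefree_monomial_ideal I.

Definition face_monomial (k : fieldType) (n : nat) (F : {set 'I_n}) :
    {mpoly k[n]} :=
  \prod_(i in F) 'X_i.
Arguments face_monomial k {n} F.

Definition stanley_reisner_ideal (k : fieldType) (n : nat)
    (D : {set {set 'I_n}}) : set {mpoly k[n]} :=
  ideal_gen [set face_monomial k F | F in [set F : {set 'I_n} | F \notin D]].
Arguments stanley_reisner_ideal k {n} D.

(** * Consequences of the recursive definitions *)

Lemma constructible_complex_pure (n : nat) (D : {set {set 'I_n}}) :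
  constructible_complex D ->
  [/\ simplicial_complex D, pure_complex D
    & forall F, F \in facets D -> face_dim F = complex_dim D].
Proof.
elim=> {D} [D [cD /eqP/cards1P[A fD]] | d D1 D2 _ [c1 p1 f1] d1 _ [c2 p2 f2] d2 _ _ _].
  split=> // [F G | F FD].
    by rewrite !fD !inE => /eqP-> /eqP->.
  rewrite /face_dim /complex_dim; congr (Posz _ - 1).
  have FA : F = A by move: FD; rewrite fD inE => /eqP.
  have FinD : F \in D by move: FD; rewrite inE => /maxsetp.
  apply/eqP; rewrite eqn_leq (bigD1 F) //= leq_maxl /=.
  rewrite geq_max leqnn /=; apply/bigmax_leqP => G /andP[GD _].
  have [H mH sGH] := maxset_exists (P := fun G : {set 'I_n} => G \in D) GD.
  have : H \in facets D by rewrite inE.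
  by rewrite fD inE -FA => /eqP HF; rewrite -HF subset_leq_card.
have cU : simplicial_complex (D1 :|: D2)%SET.
  by move=> F G; rewrite !inE => /orP[] FD GF;
    [rewrite (c1 _ _ FD GF) | rewrite (c2 _ _ FD GF) orbT].
have dU : complex_dim (D1 :|: D2)%SET = d.
  have e : (\max_(F in D1) #|F|)%N = (\max_(F in D2) #|F|)%N.
    by move: d1; rewrite -d2 => /addIr [].
  rewrite -d1 /complex_dim; congr (Posz _ - 1).
  apply/eqP; rewrite eqn_leq; apply/andP; split; apply/bigmax_leqP => F.
    by rewrite inE => /orP[] FD; [|rewrite e]; apply: leq_bigmax_cond.
  by move=> FD; apply: leq_bigmax_cond; rewrite inE FD.
have fU F : F \in facets (D1 :|: D2)%SET -> face_dim F = d.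
  rewrite inE => /maxsetP[]; rewrite inE => /orP[] FD mF.
    rewrite -d1; apply: f1; rewrite inE; apply/maxsetP; split=> // B BD.
    by apply: mF; rewrite inE BD.
  rewrite -d2; apply: f2; rewrite inE; apply/maxsetP; split=> // B BD.
  by apply: mF; rewrite inE BD orbT.
by split=> // [F G FU GU | F FU]; rewrite ?dU fU // fU.
Qed.

Lemma ideal_gen_ideal (R : comNzRingType) (G : set R) : is_ideal (ideal_gen G).
Proof.
split=> [J [[]] // | p q Ip Iq J JG | a p Ip J JG].
  by case: (JG) => -[_ + _] _; apply; [apply: Ip | apply: Iq].
by case: (JG) => -[_ _ +] _; apply; apply: Ip.
Qed.

Lemma ideal_add_gen (R : comNzRingType) (G H : set R) :
  ideal_add (ideal_gen G) (ideal_gen H) = ideal_gen (G `|` H).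
Proof.
have [G0 GD GM] := ideal_gen_ideal G; have [H0 HD HM] := ideal_gen_ideal H.
apply/seteqP; split=> [_ [p Gp [q Hq <-]] J [iJ GHJ] | ].
  have [_ JD _] := iJ.
  by apply: JD; [apply: Gp | apply: Hq]; split=> // x xG; apply: GHJ; [left|right].
apply: smallest_sub => [| x [xG|xH]].
- split; first by exists 0 => //; exists 0; rewrite ?addr0.
    move=> _ _ [p Gp [q Hq <-]] [r Gr [s Hs <-]].
    by exists (p + r); [exact: GD | exists (q + s); [exact: HD | rewrite addrACA]].
  move=> a _ [p Gp [q Hq <-]].
  by exists (a * p); [exact: GM | exists (a * q); [exact: HM | rewrite mulrDr]].
- by exists x; [exact: sub_gen_smallest | exists 0; rewrite ?addr0].
- by exists 0 => //; exists x; [exact: sub_gen_smallest | rewrite add0r].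
Qed.

Lemma constructible_ideal_generated (k : fieldType) (n : nat)
    (I : set {mpoly k[n]}) :
  constructible_ideal I -> exists q : nat, generated_in_degree q I.
Proof.
case=> {I} [u | q I1 I2 _ [M1 [d1 ->]] _ [M2 [d2 ->]] _ _].
  exists (mdeg u), [set u]; split=> [m -> // |].
  by rewrite /monomial_ideal_gen image_set1.
exists q, (M1 `|` M2); split=> [m [/d1|/d2] // |].
by rewrite ideal_add_gen /monomial_ideal_gen image_setU.
Qed.

(* Main.v *)
Require Import Defs.
From mathcomp Require Import all_boot all_order all_algebra.
From mathcomp Require Import mpoly.
From mathcomp Require Import boolp classical_sets.

(** A monomial [x^m] lies in [I_{D^\vee}] iff the complement of its support is a
    face of [D].  Hence [D |-> I_{D^\vee}] is a bijection from complexes to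
    squarefree monomial ideals which turns unions into sums, intersections into
    intersections, simplices into principal ideals, and pure complexes of
    dimension [n - q - 1] into ideals generated in degree [q]; it carries one
    recursion to the other.  In the direction from ideals to complexes, the
    summands of a squarefree ideal have to be shown squarefree. *)

Section AlexanderDualIdeals.

Set Implicit Arguments.
Unset Strict Implicit.
Unset Printing Implicit Defensive.

Import GRing.Theory.

Local Open Scope ring_scope.
Local Open Scope classical_set_scope.

Variables (k : fieldType) (n : nat).

Implicit Types (D : {set {set 'I_n}}) (F G : {set 'I_n}) (m u : 'X_{1..n}).
Implicit Types (I J : set {mpoly k[n]}) (M : set 'X_{1..n}).

(** * Membership in monomial ideals *)

(** The polynomials satisfying the divisibility test form an ideal containing the generators, hence
    containing the generated ideal; conversely such a polynomial is the sum of its terms, each a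
    multiple of a generator. *)
Lemma mem_monomial_ideal_gen M (p : {mpoly k[n]}) :
  monomial_ideal_gen k M p <->
  forall m, m \in msupp p -> exists2 u, M u & (u <= m)%MM.
Proof.
split=> [|Mp]; last first.
  have [I0 ID IM] := ideal_gen_ideal [set 'X_[k, m] | m in M].
  rewrite [p]mpolyE big_seq; apply: big_ind => // m /Mp[u Mu lum].
  rewrite -mul_mpolyC -(submK lum) mpolyXD mulrA; apply: IM.
  by apply: sub_gen_smallest; exists u.
move: p; apply: smallest_sub => [|_ [u Mu <-] m]; last first.
  by rewrite msuppX inE => /eqP ->; exists u => //; exact: lepm_refl.
split=> [m | p q Mp Mq m | a p Mp m].
- by rewrite msupp0.
- by move=> /msuppD_le; rewrite mem_cat => /orP[/Mp|/Mq].
- move=> /msuppM_le /allpairsP[[m1 m2] /= [_ /Mp[u Mu lum] ->]].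
  by exists u => //; apply: lepm_trans lum (lem_addl _ _).
Qed.

Lemma mem_monomial_ideal_genX M m :
  monomial_ideal_gen k M 'X_[m] <-> exists2 u, M u & (u <= m)%MM.
Proof.
rewrite mem_monomial_ideal_gen; split=> [|Mm m'].
  by apply; rewrite msuppX mem_head.
by rewrite msuppX inE => /eqP ->.
Qed.

(** * Supports and squarefree monomials *)

Definition mnm_supp m : {set 'I_n} := [set i | m i != 0%N]%SET.

(** [mesym1 F] is the exponent vector of $x_F$. This adjunction with [mnm_supp] turns divisibility
    by squarefree monomials into inclusion of sets. *)
Lemma mesym1_lep F m : (mesym1 F <= m)%MM = (F \subset mnm_supp m).
Proof.
apply/mnm_lepP/fintype.subsetP => [h i iF|h i].
  by have := h i; rewrite mnmE iF inE lt0n.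
by rewrite mnmE; case: (boolP (i \in F)) => // /h; rewrite inE lt0n.
Qed.

Lemma mnm_supp_mesym1 F : mnm_supp (mesym1 F) = F.
Proof. by apply/setP => i; rewrite inE mnmE; case: (i \in F). Qed.

Lemma mesym1_mnm_supp_le m : (mesym1 (mnm_supp m) <= m)%MM.
Proof. by rewrite mesym1_lep. Qed.

Lemma lep_mesym1 m F : (m <= mesym1 F)%MM -> mesym1 (mnm_supp m) = m.
Proof.
move=> /mnm_lepP h; apply/mnmP => i; rewrite mnmE inE.
by have := h i; rewrite mnmE; case: (m i) => [|[|j]] //; case: (i \in F).
Qed.

Lemma squarefree_mesym1 m :
  (forall i, (m i <= 1)%N) -> mesym1 (mnm_supp m) = m.
Proof.
move=> h; apply: (@lep_mesym1 _ finset.setT); apply/mnm_lepP => i.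
by rewrite mnmE finset.in_setT.
Qed.

Lemma mnm_supp_sub m u : (u <= m)%MM -> mnm_supp u \subset mnm_supp m.
Proof.
by rewrite -mesym1_lep; apply: lepm_trans; apply: mesym1_mnm_supp_le.
Qed.

Lemma lep_mdeg_eq m u : (u <= m)%MM -> mdeg u = mdeg m -> u = m.
Proof.
move=> lum; rewrite -{1 2}(submK lum) mdegD => /esym/eqP.
by rewrite -{2}[mdeg u]add0n eqn_add2r mdeg_eq0 => /eqP ->; rewrite add0m.
Qed.

Lemma face_monomialE F : face_monomial k F = 'X_[mesym1 F].
Proof.
rewrite /face_monomial mprodXE; congr 'X_[_]; apply/mnmP => i.
rewrite mnm_sumE mnmE (eq_bigr (fun j => (j == i) : nat)) => [|j _]; last first.
  by rewrite mnm1E.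
case: (boolP (i \in F)) => iF.
  by rewrite (bigD1 i) //= eqxx big1 // => j /andP[_ /negPf->].
by rewrite big1 // => j jF; case: eqP => // e; rewrite -e jF in iF.
Qed.

(** * The ideal of the Alexander dual *)

Local Notation dual_ideal D := (stanley_reisner_ideal k (alexander_dual D)).

Lemma dual_idealE D :
  dual_ideal D =
  monomial_ideal_gen k [set mesym1 (~: F)%SET | F in [set F | F \in D]].
Proof.
rewrite /stanley_reisner_ideal /monomial_ideal_gen; congr ideal_gen.
have dualE F : (F \in alexander_dual D) = (~: F \notin D)%SET.
  apply/imsetP/idP => [[G]|nD]; first by rewrite inE => nG ->; rewrite finset.setCK.
  by exists (~: F)%SET; rewrite ?finset.setCK // inE.
apply/seteqP; split=> [_ [F /= + <-]|_ [_ [F /= FD <-] <-]].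
  rewrite dualE negbK face_monomialE => FD.
  by exists (mesym1 F) => //; exists (~: F)%SET; rewrite ?finset.setCK.
exists (~: F)%SET; rewrite /= ?face_monomialE //.
by rewrite dualE finset.setCK negbK.
Qed.

(** A generator $x_{[n]\setminus F}$ divides $x^m$ iff the complement of the support of $m$ is
    contained in $F$; as [D] is closed under subsets, some face $F$ does this iff that complement is
    itself a face. *)
Lemma mem_dual_ideal D (p : {mpoly k[n]}) : simplicial_complex D ->
  dual_ideal D p <-> forall m, m \in msupp p -> ~: mnm_supp m \in D.
Proof.
move=> cD; rewrite dual_idealE mem_monomial_ideal_gen.
split=> h m /h => [[_ [F FD <-]]|mD].
  by rewrite mesym1_lep -finset.setCS finset.setCK; apply: cD.
exists (mesym1 (mnm_supp m)); last exact: mesym1_mnm_supp_le.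
by exists (~: mnm_supp m)%SET; rewrite ?finset.setCK.
Qed.

Lemma mem_dual_idealX D m : simplicial_complex D ->
  dual_ideal D 'X_[m] <-> ~: mnm_supp m \in D.
Proof.
move=> /mem_dual_ideal->; split=> [|mD m']; first by apply; rewrite msuppX inE.
by rewrite msuppX inE => /eqP ->.
Qed.

Lemma dual_idealU D1 D2 :
  dual_ideal (D1 :|: D2) = ideal_add (dual_ideal D1) (dual_ideal D2).
Proof.
rewrite !dual_idealE /monomial_ideal_gen ideal_add_gen -!image_setU.
by congr (ideal_gen (image (image _ _) _)); apply/seteqP; split=> F /=;
  rewrite inE => /orP.
Qed.

Lemma simplicial_complexI D1 D2 :
  simplicial_complex D1 -> simplicial_complex D2 ->
  simplicial_complex (D1 :&: D2).
Proof.
move=> c1 c2 F G; rewrite !inE => /andP[F1 F2] GF.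
by rewrite (c1 _ _ F1 GF) (c2 _ _ F2 GF).
Qed.

Lemma simplicial_complexU D1 D2 :
  simplicial_complex D1 -> simplicial_complex D2 ->
  simplicial_complex (D1 :|: D2).
Proof.
move=> c1 c2 F G; rewrite !inE => /orP[F1|F2] GF.
  by rewrite (c1 _ _ F1 GF).
by rewrite (c2 _ _ F2 GF) orbT.
Qed.

(** Membership is tested on each monomial separately by a condition on one face, so it commutes with
    intersections. *)
Lemma dual_idealI D1 D2 :
  simplicial_complex D1 -> simplicial_complex D2 ->
  dual_ideal (D1 :&: D2) = dual_ideal D1 `&` dual_ideal D2.
Proof.
move=> c1 c2; apply/seteqP; split=> p.
  rewrite /setI /= !mem_dual_ideal //; last exact: simplicial_complexI.
  by move=> h; split=> m /h; rewrite inE => /andP[].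
move=> [/mem_dual_ideal h1 /mem_dual_ideal h2].
apply/mem_dual_ideal => [|m mp]; first exact: simplicial_complexI.
by rewrite inE h1 ?h2.
Qed.

Lemma dual_ideal_squarefree D : squarefree_monomial_ideal (dual_ideal D).
Proof.
rewrite dual_idealE; eexists; split; last by [].
by move=> _ [F _ <-] i; rewrite mnmE leq_b1.
Qed.

(** * Recovering the complex from the ideal *)

(* The inverse of [D |-> I_{D^\vee}] on squarefree monomial ideals. *)
Definition codual I : {set {set 'I_n}} :=
  [set F | `[< I 'X_[mesym1 (~: F)] >]]%SET.

Lemma mem_codual I F : F \in codual I <-> I 'X_[mesym1 (~: F)%SET].
Proof. by rewrite inE; split=> /asboolP. Qed.

Lemma codualI I J : codual (I `&` J) = codual I :&: codual J.
Proof.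
apply/setP => F; rewrite finset.in_setI.
by apply/idP/andP => [/mem_codual[]|[]];
  [split; apply/mem_codual | move=> /mem_codual ? /mem_codual ?; apply/mem_codual].
Qed.

Lemma dual_idealK D : simplicial_complex D -> codual (dual_ideal D) = D.
Proof.
move=> cD; apply/setP => F; apply/idP/idP; rewrite mem_codual.
  by rewrite mem_dual_idealX // mnm_supp_mesym1 finset.setCK.
by move=> FD; rewrite mem_dual_idealX // mnm_supp_mesym1 finset.setCK.
Qed.

Lemma codual_complex M : simplicial_complex (codual (monomial_ideal_gen k M)).
Proof.
move=> F G /mem_codual/mem_monomial_ideal_genX[u Mu lu] GF.
apply/mem_codual/mem_monomial_ideal_genX; exists u => //.
by apply: lepm_trans lu _; rewrite mesym1_lep mnm_supp_mesym1 finset.setCS.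
Qed.

Lemma squarefree_complex I :
  squarefree_monomial_ideal I -> simplicial_complex (codual I).
Proof. by move=> [M [_ ->]]; apply: codual_complex. Qed.

(** A squarefree generator divides $x^m$ iff it divides the product of the variables in the support
    of $m$, so a squarefree ideal is determined by its squarefree monomials. *)
Lemma codualK I : squarefree_monomial_ideal I -> dual_ideal (codual I) = I.
Proof.
move=> [M [sqM ->]]; have cM := codual_complex (M := M).
apply/seteqP; split=> p.
  move=> /(mem_dual_ideal _ cM) h; apply/mem_monomial_ideal_gen => m /h.
  move=> /mem_codual/mem_monomial_ideal_genX[u Mu]; rewrite finset.setCK => lu.
  by exists u => //; apply: lepm_trans lu (mesym1_mnm_supp_le _).
move=> /mem_monomial_ideal_gen h; apply/(mem_dual_ideal _ cM) => m /h[u Mu lu].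
apply/mem_codual/mem_monomial_ideal_genX; exists u; rewrite // finset.setCK.
rewrite -(squarefree_mesym1 (sqM _ Mu)) mesym1_lep mnm_supp_mesym1.
exact: mnm_supp_sub.
Qed.

(** * Facets, generating degree and dimension *)

Lemma facet_exists D F :
  F \in D -> exists2 G, G \in facets D & F \subset G.
Proof.
by move=> /maxset_exists[G mG FG]; exists G; rewrite // inE.
Qed.

Lemma mem_facets D F : F \in facets D -> F \in D.
Proof. by rewrite inE => /maxsetp. Qed.

(** The complements of facets are the minimal generators: a generator dividing $x_{[n]\setminus F}$
    yields a face containing $F$, which is $F$ itself when $F$ is a facet. *)
Lemma generated_dual_ideal D q : simplicial_complex D ->
  generated_in_degree q (dual_ideal D) <->
  forall F, F \in facets D -> (#|F| + q = n)%N.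
Proof.
move=> cD; split=> [[M [dM MD]] F fF|dD].
  have /maxsetP[FD maxF] : maxset (fun G => G \in D) F by move: fF; rewrite inE.
  have /mem_monomial_ideal_genX[u Mu lu] :
      monomial_ideal_gen k M 'X_[mesym1 (~: F)%SET].
    by rewrite -MD mem_dual_idealX // mnm_supp_mesym1 finset.setCK.
  have uD : ~: mnm_supp u \in D.
    rewrite -mem_dual_idealX // MD mem_monomial_ideal_genX.
    by exists u; last exact: lepm_refl.
  have suF : mnm_supp u \subset ~: F.
    by rewrite -(mnm_supp_mesym1 (~: F)) mnm_supp_sub.
  have uF : (~: mnm_supp u = F)%SET by apply: maxF; rewrite // -finset.setCS finset.setCK.
  (* As a divisor of a squarefree monomial, [u] is squarefree, so its degree is the size of its
     support. *)
  by rewrite -(dM _ Mu) -(lep_mesym1 lu) mdeg_mesym1 -uF addnC cardsC card_ord.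
exists [set mesym1 (~: F)%SET | F in [set F | F \in facets D]]; split.
  move=> _ [F /= /dD e <-]; rewrite mdeg_mesym1.
  by apply/eqP; rewrite -(eqn_add2l #|F|) e cardsC card_ord.
apply/seteqP; split=> p; rewrite mem_monomial_ideal_gen mem_dual_ideal //.
  move=> h m /h /facet_exists[F fF mF].
  by exists (mesym1 (~: F)%SET); [exists F|rewrite mesym1_lep -finset.setCS finset.setCK].
move=> h m /h[_ [F /= /mem_facets FD <-]].
by rewrite mesym1_lep -finset.setCS finset.setCK; apply: cD.
Qed.

(** Provides a facet through which degree and dimension can be compared; the family without faces
    has zero dual ideal, generated in every degree by the empty set. *)
Lemma constructible_nonempty D : constructible_complex D -> exists F, F \in D.
Proof.
elim=> {D} [D [_ /eqP/cards1P[F fD]]|d D1 D2 _ [F F1] _ _ _ _ _ _ _].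
  by exists F; apply: mem_facets; rewrite fD inE.
by exists F; rewrite inE F1.
Qed.

Lemma generated_dual_ideal_dim D q : constructible_complex D ->
  generated_in_degree q (dual_ideal D) <-> complex_dim D = n%:Z - q%:Z - 1.
Proof.
move=> kD; have [cD _ fD] := constructible_complex_pure kD.
have [F0 /facet_exists[F fF _]] := constructible_nonempty kD.
rewrite generated_dual_ideal //; split=> [h|dimD G fG].
  rewrite -(fD F fF) /face_dim; congr (_ - 1).
  by apply/eqP; rewrite eq_sym subr_eq -PoszD h.
apply/eqP; rewrite -eqz_nat PoszD eq_sym -subr_eq; apply/eqP.
by apply: (addIr (-1)); rewrite -dimD -(fD G fG).
Qed.

Lemma dual_ideal_generated D : constructible_complex D ->
  exists q, generated_in_degree q (dual_ideal D).
Proof.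
move=> kD; have [cD _ fD] := constructible_complex_pure kD.
have [F0 /facet_exists[F fF _]] := constructible_nonempty kD.
exists #|~: F|; apply/generated_dual_ideal_dim => //.
rewrite -(fD F fF) /face_dim; congr (_ - 1).
by apply/eqP; rewrite eq_sym subr_eq -PoszD cardsC card_ord.
Qed.

(** * From constructible complexes to constructible ideals *)

Lemma dual_ideal_constructible D :
  constructible_complex D -> constructible_ideal (dual_ideal D).
Proof.
elim=> {D} [D [cD /eqP/cards1P[A fD]]|d D1 D2 k1 I1 d1 k2 I2 d2 kI II dI].
  have AD : A \in D by apply: mem_facets; rewrite fD inE.
  (* Every face lies in the unique facet [A], so $x_{[n]\setminus A}$ divides all the other
     generators. *)
  suff -> : dual_ideal D = ideal_gen [set 'X_[mesym1 (~: A)%SET]].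
    exact: ConstructiblePrincipal.
  rewrite -(image_set1 (fun m => 'X_[m])) -/(monomial_ideal_gen k _).
  apply/seteqP; split=> p; rewrite mem_monomial_ideal_gen mem_dual_ideal //.
    move=> h m /h /facet_exists[F]; rewrite fD inE => /eqP -> mA.
    by exists (mesym1 (~: A)%SET); rewrite // mesym1_lep -finset.setCS finset.setCK.
  move=> h m /h[_ ->]; rewrite mesym1_lep -finset.setCS finset.setCK; exact: cD.
have [q g1] := dual_ideal_generated k1.
have dq := (generated_dual_ideal_dim q k1).1 g1.
have [c1 _ _] := constructible_complex_pure k1.
have [c2 _ _] := constructible_complex_pure k2.
rewrite dual_idealU; apply: (ConstructibleSum (q := q)) => //.
- by apply/generated_dual_ideal_dim; rewrite // d2 -d1.
- by rewrite -dual_idealI.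
(* Codimension one in the complex is one degree more in the ideal: $(n-q-1)-1=n-(q+1)-1$. *)
- rewrite -dual_idealI //; apply/generated_dual_ideal_dim => //.
  by rewrite dI -d1 dq -addn1 PoszD opprD addrA.
Qed.

(** * From squarefree constructible ideals to constructible complexes *)

(* A degree-q monomial of a squarefree ideal generated in degree q is itself
   squarefree, as it equals the generator dividing it. *)
Lemma squarefree_summand I J q :
  generated_in_degree q I -> generated_in_degree q J ->
  squarefree_monomial_ideal (ideal_add I J) -> squarefree_monomial_ideal I.
Proof.
move=> [M1 [d1 ->]] [M2 [d2 ->]] [M [sqM]].
rewrite ideal_add_gen -image_setU -!/(monomial_ideal_gen k _) => MU.
exists M1; split=> // m M1m i.
have /mem_monomial_ideal_genX[u Mu lum] : monomial_ideal_gen k M 'X_[m].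
  by rewrite -MU mem_monomial_ideal_genX; exists m; [left|exact: lepm_refl].
have /mem_monomial_ideal_genX[v Mv lvu] :
    monomial_ideal_gen k (M1 `|` M2) 'X_[u].
  by rewrite MU mem_monomial_ideal_genX; exists u; last exact: lepm_refl.
suff <- : u = m by apply: sqM.
have lvm := lepm_trans lvu lum.
have vm : v = m.
  apply: lep_mdeg_eq lvm _; rewrite (d1 _ M1m).
  by case: Mv => [/d1|/d2].
apply/mnmP => j; apply/eqP; rewrite eqn_leq (mnm_lepP lum) /=.
by rewrite -vm (mnm_lepP lvu).
Qed.

Lemma ideal_addC I J : ideal_add I J = ideal_add J I.
Proof.
apply/seteqP; split=> _ [p Ip [q Jq <-]];
  by exists q => //; exists p; rewrite // addrC.
Qed.

(** Squarefreeness stays a premise of the induction statement, so it must be established for both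
    summands and for their intersection before the induction hypotheses apply. *)
Lemma codual_constructible I :
  constructible_ideal I -> squarefree_monomial_ideal I ->
  constructible_complex (codual I).
Proof.
elim=> {I} [u|q I1 I2 _ k1 g1 _ k2 g2 _ kI gI] sq.
  have sc := squarefree_complex sq; apply: ConstructibleSimplex; split=> //.
  have memE F : F \in codual (ideal_gen [set 'X_[u]]) <->
      (u <= mesym1 (~: F)%SET)%MM.
    rewrite mem_codual -(image_set1 (fun m => 'X_[m])).
    rewrite -/(monomial_ideal_gen k _) mem_monomial_ideal_genX.
    by split=> [[_ ->]|lu]; last exists u.
  (* Some squarefree generator [v] divides [u], and [v] lies in $(u)$, so [u] divides [v]; thus
     [u = v] is squarefree. *)
  have uE : mesym1 (mnm_supp u) = u.
    case: sq => M [sqM MU].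
    have /mem_monomial_ideal_genX[v Mv lvu] : monomial_ideal_gen k M 'X_[u].
      by rewrite -MU; apply: sub_gen_smallest.
    suff <- : v = u by apply/squarefree_mesym1/sqM.
    have /mem_monomial_ideal_genX[_ -> luv] :
        monomial_ideal_gen k [set u] 'X_[v].
      rewrite /monomial_ideal_gen image_set1 MU.
      by apply: sub_gen_smallest; exists v.
    by apply/mnmP => j; apply/eqP; rewrite eqn_leq !(mnm_lepP _).
  have memP F : (F \in codual (ideal_gen [set 'X_[u]])) =
      (F \subset ~: mnm_supp u).
    apply/idP/idP; rewrite memE -uE mesym1_lep !mnm_supp_mesym1.
      by rewrite -finset.setCS finset.setCK.
    by move=> h; rewrite -finset.setCS finset.setCK.
  apply/eqP/cards1P; exists (~: mnm_supp u)%SET; apply/setP => F.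
  rewrite finset.in_set1 [F \in facets _]inE.
  apply/maxsetP/eqP => [[FD maxF]|->].
    by apply/esym/maxF; rewrite ?memP // -memP.
  split=> [|G]; first by rewrite memP.
  by rewrite memP => Gu uG; apply/eqP; rewrite finset.eqEsubset Gu uG.
have sq1 := squarefree_summand g1 g2 sq.
have sq2 : squarefree_monomial_ideal I2.
  by apply: squarefree_summand g2 g1 _; rewrite ideal_addC.
have [c1 c2] := (squarefree_complex sq1, squarefree_complex sq2).
(* The intersection is exhibited as a dual ideal because every dual ideal is squarefree. *)
have eI : dual_ideal (codual I1 :&: codual I2) = I1 `&` I2.
  by rewrite dual_idealI // !codualK.
have sqI : squarefree_monomial_ideal (I1 `&` I2).
  by rewrite -eI; apply: dual_ideal_squarefree.
have eU : codual (ideal_add I1 I2) = codual I1 :|: codual I2.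
  rewrite -{1}(codualK sq1) -{1}(codualK sq2) -dual_idealU dual_idealK //.
  exact: simplicial_complexU.
(* The value of [d] is the dimension that corresponds to generation in degree [q]. *)
rewrite eU; apply: (ConstructibleUnion (d := n%:Z - q%:Z - 1)).
- exact: k1.
- by apply/generated_dual_ideal_dim; [apply: k1 | rewrite codualK].
- exact: k2.
- by apply/generated_dual_ideal_dim; [apply: k2 | rewrite codualK].
- by rewrite -codualI; apply: kI.
- rewrite -codualI.
  have /generated_dual_ideal_dim -> : generated_in_degree q.+1
      (dual_ideal (codual (I1 `&` I2))) by rewrite codualK.
    by rewrite -addn1 PoszD opprD addrA.
  exact: kI.
Qed.

End AlexanderDualIdeals.

Theorem theorem3p1p4 (k : fieldType) (n : nat) (D : {set {set 'I_n}})
    (complexD : simplicial_complex_on D) (pureD : pure_complex D) :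
  constructible_complex D <->
  squarefree_constructible_ideal (stanley_reisner_ideal k (alexander_dual D)).
Proof.
have [cD _] := complexD.
split=> [kD|[kI sqI]]; last first.
  (* [D] is recovered as the [codual] of its own dual ideal. *)
  by rewrite -(dual_idealK k cD); exact: codual_constructible.
by split; [exact: dual_ideal_constructible | exact: dual_ideal_squarefree].
Qed.
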